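(* For every prime $p\ge 5$ and every positive integer $m$, there exists a $2$-generator finite $p$-group $G$ such that: (i) if $\exp G=p^e$ then $|G^{p^{e-1}}|=p^m$; (ii) $G$ is not a Beauville group.
   Context: A $2$-generator finite $p$-group is one whose minimal number of generators is $2$. $G^{p^i}$ is the subgroup generated by all $g^{p^i}$, $g\in G$. For $x,y\in G$ let $\Sigma(x,y)=\bigcup_{g\in G}\big(\langle x\rangle^g\cup\langle y\rangle^g\cup\langle xy\rangle^g\big)$. A Beauville structure for $G$ is a pair of generating sets $\{x_1,y_1\}$, $\{x_2,y_2\}$ of $G$ such that $\Sigma(x_1,y_1)\cap\Sigma(x_2,y_2)=1$. $G$ is a Beauville group if it has a Beauville structure. *)

(* Defs.v *)
From HB Require Import structures.
From mathcomp Require Import all_boot all_order all_fingroup all_solvable.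

Set Implicit Arguments.
Unset Strict Implicit.
Unset Printing Implicit Defensive.

Local Open Scope group_scope.

Definition beauville_sigma (gT : finGroupType) (G : {group gT}) (x y : gT)
    : {set gT} :=
  \bigcup_(g in G) (<[x]> :^ g :|: <[y]> :^ g :|: <[x * y]> :^ g).

Definition beauville_structure (gT : finGroupType) (G : {group gT})
    (x1 y1 x2 y2 : gT) : Prop :=
  [/\ <<[set x1; y1]>> = G,
      <<[set x2; y2]>> = G
    & beauville_sigma G x1 y1 :&: beauville_sigma G x2 y2 = 1].

Definition beauville_group (gT : finGroupType) (G : {group gT}) : Prop :=
  exists x1 y1 x2 y2 : gT, beauville_structure G x1 y1 x2 y2.

(* Main.v *)
From HB Require Import structures.
Require Import Defs.
From mathcomp Require Import all_boot all_order all_fingroup all_solvable.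
From mathcomp Require Import ssralg finalg zmodp.

(** A p-group G of exponent p ^ e in which the elements x outside some proper
    subgroup H all have a power equal to one fixed z <> 1 cannot be a Beauville
    group: a generating pair cannot lie inside H, so z belongs to every
    beauville_sigma G x y ([not_beauville_of_common_element]).  This leaves the
    elements of H free to have many p ^ e.-1 -th powers, and the point is to
    find a 2-generator group in which they do.

    Fix r, let N = p ^ r.+2, n = p ^ r.+1 and q = p ^ r, and work in the regular
    wreath product of Z/N by Z/N, whose elements are pairs (i, f) of a shift i
    and a function f.  Keep only the pairs in which f is balanced: its sum over
    each arithmetic progression x, x + q, ..., x + (p - 1)q is 0.  Such f have
    period n = pq, which yields a dichotomy ([balanced_expn]).  If n does not
    divide i, some p-power multiple of i is q times a number prime to p, so a
    p-th power already collects a sum over such a progression and has zero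
    function part; hence (i, f)^n = (ni, 0).  If n divides i, shifting by i
    fixes f, and (i, f)^n = (0, nf).  In particular the exponent is N, and
    if p does not divide i then (i, f)^n generates the subgroup of order p
    spanned by z = (n, 0).

    Let P be generated by the unit shift and one balanced function (the seed).
    Then 'Mho^(r.+1)(P) is <z> times its intersection B with the base group,
    and |B| >= p ^ q because q translates of the seed remain linearly
    independent modulo p ([leq_card_base_Mho]).  Choosing r large makes
    'Mho^(r.+1)(P) as large as desired, and dividing P by a normal subgroup of
    suitable order inside B brings it down to order exactly p ^ m without
    touching z ([exists_quotient_small_Mho]). *)

Set Implicit Arguments.
Unset Strict Implicit.
Unset Printing Implicit Defensive.

(** * Obstruction to Beauville structures, and quotients with small agemo *)

Local Open Scope group_scope.

(** Of two generators at least one lies outside H, which already puts z into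
    the set Sigma of the pair; so no two such sets meet trivially. *)
Lemma not_beauville_of_common_element (gT : finGroupType) (G H : {group gT})
    (z : gT) :
    H \proper G -> z != 1 -> {in G :\: H, forall x, z \in <[x]>} ->
  ~ beauville_group G.
Proof.
move=> ltHG nz1 Hz [x1 [y1 [x2 [y2 [G1 G2 S12]]]]].
have zS x y : <<[set x; y]>> = G -> z \in beauville_sigma G x y.
  move=> defG; apply/bigcupP; exists 1; rewrite ?group1 // !conjsg1 !inE.
  have Gxy u : u \in [set x; y] -> u \in G.
    by move=> uxy; rewrite -defG mem_gen.
  have [Hx | nHx] := boolP (x \in H); last first.
    by rewrite (Hz x) // inE nHx Gxy // set21.
  have [Hy | nHy] := boolP (y \in H); last first.
    by rewrite (Hz y) ?orbT // inE nHy Gxy // set22.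
  case/negP: (proper_subn ltHG).
  by rewrite -defG gen_subG subUset !sub1set Hx Hy.
have: z \in beauville_sigma G x1 y1 :&: beauville_sigma G x2 y2.
  by rewrite inE !zS.
by rewrite S12 inE (negPf nz1).
Qed.

(** By [normal_pgroup], the part of the agemo that lies in A contains normal
    subgroups Q of P of every order dividing its own.  As Q lies in A, the
    image of z in P / Q is still nontrivial, and the obstruction above passes to P / Q.  The
    element of A outside the agemo serves to keep P / Q from being cyclic: in
    a cyclic p-group the image of that element would generate a subgroup
    containing the image of z. *)
Lemma exists_quotient_small_Mho (gT : finGroupType) (p k m : nat)
    (P H A : {group gT}) (z : gT) :
    prime p -> 0 < m -> p.-group P -> 'm(P) <= 2 -> exponent P %| p ^ k.+1 ->
    H \proper P -> A <| P -> A \subset H -> #[z] = p -> z \notin A ->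
    {in P :\: H, forall x, z \in <[x]>} ->
    z \in 'Mho^k(P) -> 'Mho^k(P) \subset <[z]> * A ->
    ~~ (A \subset 'Mho^k(P)) ->
    p ^ m.-1 <= #|A :&: 'Mho^k(P)| ->
  exists Q : {group gT},
    [/\ p.-group (P / Q), 'm(P / Q) = 2,
        (forall e, exponent (P / Q) = (p ^ e)%N ->
           #|'Mho^(e.-1)(P / Q)| = (p ^ m)%N)
      & ~ beauville_group (P / Q)].
Proof.
move=> p_pr m_gt0 pP mP expP ltHP nsAP sAH oz nAz Pz Mz sMzA nsAM leB.
set M := 'Mho^k(P); pose B := (A :&: M)%G.
have p_gt1 := prime_gt1 p_pr.
have nsMP : M <| P := Mho_normal k P.
have nsBP : B <| P by rewrite normalI.
have pB : p.-group B := pgroupS (normal_sub nsBP) pP.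
have tiz : <[z]> :&: A = 1 by rewrite prime_TIg -?orderE ?oz // cycle_subG.
have oM : #|M| = (p * #|B|)%N.
  have defM : M = <[z]> * B.
    rewrite (@group_modl _ _ _ 'Mho^k(P)%G) ?cycle_subG //.
    exact/esym/setIidPr.
  rewrite defM TI_cardMg -?orderE ?oz //.
  by apply/trivgP; rewrite -tiz setIS // subsetIl.
have [l oB] := p_natP pB.
have lem : m.-1 <= l by move: leB; rewrite oB leq_exp2l.
have lelB : l - m.-1 <= logn p #|B| by rewrite oB pfactorK // leq_subr.
have [Q [sQB nsQP oQ]] := normal_pgroup pP nsBP lelB.
have sQA : Q \subset A := subset_trans sQB (subsetIl _ _).
have sQM : Q \subset M := subset_trans sQB (subsetIr _ _).
have nQP := normal_norm nsQP; exists Q.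
have oMQ : #|'Mho^k(P / Q)| = (p ^ m)%N.
  have <- : 'Mho^k(P) / Q = 'Mho^k(P / Q).
    exact: (morphim_Mho k (coset_morphism Q) nQP).
  rewrite card_quotient; last first.
    exact: subset_trans (normal_sub nsMP) nQP.
  rewrite -divgS // oM oQ oB -expnS -expnB ?prime_gt0 //; last first.
    by rewrite (leq_trans (leq_subr _ _)).
  by congr (_ ^ _)%N; rewrite subSn ?leq_subr // subKn // prednK.
have pPQ : p.-group (P / Q) by exact: quotient_pgroup.
(* A smaller exponent would make the agemo of P / Q trivial. *)
have expPQ : exponent (P / Q) = (p ^ k.+1)%N.
  have dv : exponent (P / Q) %| p ^ k.+1.
    exact: dvdn_trans (exponent_quotient _ _) expP.
  case/(dvdn_pfactor _ _ p_pr): dv => j lejk def_j; rewrite def_j.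
  congr (_ ^ _)%N; apply/eqP; rewrite eqn_leq lejk ltnNge.
  apply/negP => lejk'; have: #|'Mho^k(P / Q)| = 1%N.
    rewrite (MhoE _ pPQ); apply/eqP; rewrite -trivg_card1 -subG1 gen_subG.
    apply/subsetP=> _ /imsetP[x PQx ->]; rewrite inE.
    by apply/eqP/(exponentP _ _ PQx) ; rewrite def_j dvdn_exp2l.
  by move/eqP; rewrite oMQ -(expn0 p) eqn_exp2l // gtn_eqF.
have zN : z \in 'N(Q) by rewrite (subsetP nQP) // (subsetP (normal_sub nsMP)).
have nQz : coset Q z != 1.
  by apply: contra nAz => /eqP/(coset_idr zN)/(subsetP sQA).
split=> //.
- apply/eqP; rewrite eqn_leq (leq_trans (quotient_grank nQP)) //=.
  rewrite ltnNge; apply/negP.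
  have [C defC <-] := grank_witness (P / Q); rewrite leqNgt => oC.
  have cyc : cyclic (P / Q).
    apply/cyclicP; have:= oC; rewrite -leqNgt.
    case: (set_0Vmem C) => [C0 _ | [c Cc]].
      by exists 1; rewrite -defC C0 gen0 cycle1.
    rewrite leq_eqVlt ltnS leqn0 => /orP[/cards1P[d Cd]|].
      by exists d; rewrite -defC Cd.
    by rewrite (cardD1 c) Cc.
  (* In a cyclic group inclusion of subgroups is divisibility of orders, so the
     image of z, of order p, is a power of that of any nontrivial b. *)
  have ozQ : #[coset Q z] = p.
    apply/prime_nt_dvdP => //; first by rewrite order_eq1.
    by rewrite -oz morph_order.
  case/subsetPn: nsAM => b Ab nMb.
  have bN : b \in 'N(Q) by rewrite (subsetP nQP) // (subsetP (normal_sub nsAP)).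
  have nQb : coset Q b != 1.
    by apply: contra nMb => /eqP/(coset_idr bN)/(subsetP sQM).
  have : coset Q z \in A / Q.
    have sbA : <[coset Q b]> \subset A / Q by rewrite cycle_subG mem_quotient.
    have sAPQ : A / Q \subset P / Q := quotientS Q (normal_sub nsAP).
    have sbP := subset_trans sbA sAPQ.
    have szP : <[coset Q z]> \subset P / Q.
      by rewrite cycle_subG mem_quotient ?(subsetP (normal_sub nsMP)).
    apply: (subsetP sbA).
    rewrite -cycle_subG -(cardSg_cyclic cyc) // -orderE ozQ.
    have ntb : <[coset Q b]> != 1 by rewrite cycle_eq1.
    by case/pgroup_pdiv: (pgroupS sbP pPQ).
  rewrite -cycle_subG -quotient_cycle // quotientSGK ?cycle_subG //.
  by rewrite (negPf nAz).
- move=> e; rewrite expPQ => /eqP; rewrite eqn_exp2l // => /eqP <- /=.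
  exact: oMQ.
apply: (@not_beauville_of_common_element _ _ (H / Q) (coset Q z)) => //.
  rewrite properE quotientS ?(proper_sub ltHP) //=.
  rewrite quotientSGK //; last by exact: subset_trans sQA sAH.
  exact: proper_subn.
move=> _ /setDP[/morphimP[x Nx Px ->] nHx].
have nH : x \notin H by apply: contra nHx; apply: mem_quotient.
have /cycleP[j ->] : z \in <[x]> by rewrite Pz // inE nH.
by rewrite morphX // mem_cycle.
Qed.

(** * Regular wreath products of finite abelian groups *)

(** The regular wreath product of W by V, written with V on the left: (i, f)
    stands for the shift i followed by the base element f. *)
Definition wreath (V W : finZmodType) : Type := (V * {ffun V -> W})%type.

HB.instance Definition _ (V W : finZmodType) := Finite.on (wreath V W).

Section Wreath.
Variables V W : finZmodType.
Import GRing.Theory.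
Local Open Scope ring_scope.
Implicit Types g h : wreath V W.

Definition wreath_mul g h : wreath V W :=
  (g.1 + h.1, [ffun x => g.2 (x + h.1) + h.2 x]).
Definition wreath_one : wreath V W := (0, [ffun=> 0]).
Definition wreath_inv g : wreath V W := (- g.1, [ffun x => - g.2 (x - g.1)]).

Lemma wreath_mulA : associative wreath_mul.
Proof.
move=> f g h; congr (_, _); first by rewrite addrA.
by apply/ffunP=> x; rewrite !ffunE -!addrA /= (addrC g.1).
Qed.

Lemma wreath_mul1 : left_id wreath_one wreath_mul.
Proof.
case=> i f; congr (_, _); first by rewrite add0r.
by apply/ffunP=> x; rewrite !ffunE add0r.
Qed.

Lemma wreath_mulV : left_inverse wreath_one wreath_inv wreath_mul.
Proof.
case=> i f; congr (_, _); first by rewrite addNr.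
by apply/ffunP=> x; rewrite !ffunE /= addrK addNr.
Qed.

HB.instance Definition _ :=
  Finite_isGroup.Build (wreath V W) wreath_mulA wreath_mul1 wreath_mulV.

Lemma wreathM1 g h : (g * h)%g.1 = g.1 + h.1. Proof. by []. Qed.
Lemma wreathM2 g h x : (g * h)%g.2 x = g.2 (x + h.1) + h.2 x.
Proof. by rewrite ffunE. Qed.

Lemma wreathV1 g : (g^-1)%g.1 = - g.1. Proof. by []. Qed.
Lemma wreathJ1 g h : (h ^ g)%g.1 = h.1.
Proof. by rewrite conjgE !wreathM1 addrC addrK. Qed.

Lemma wreathX1 g l : (g ^+ l)%g.1 = g.1 *+ l.
Proof. by elim: l => // l IH; rewrite expgSr wreathM1 IH mulrSr. Qed.

Lemma wreathX2 g l x : (g ^+ l)%g.2 x = \sum_(j < l) g.2 (x + g.1 *+ j).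
Proof.
elim: l x => [|l IH] x; first by rewrite big_ord0 ffunE.
rewrite expgSr wreathM2 IH big_ord_recl mulr0n addr0 addrC; congr (_ + _).
by apply: eq_bigr => j _; rewrite -addrA -mulrS.
Qed.

Lemma wreath_baseX g l x : g.1 = 0 -> (g ^+ l)%g.2 x = g.2 x *+ l.
Proof.
move=> g1; rewrite wreathX2 (eq_bigr (fun=> g.2 x)) ?sumr_const ?card_ord //.
by move=> j _; rewrite g1 mul0rn addr0.
Qed.

Lemma wreath_base_prod (I : finType) (F : I -> wreath V W) :
    (forall i, (F i).1 = 0) ->
  (\prod_i F i)%g.1 = 0 /\ forall x, (\prod_i F i)%g.2 x = \sum_i (F i).2 x.
Proof.
move=> F1; split=> [|x].
  by apply: (big_ind (fun g : wreath V W => g.1 = 0)) => // g h g1 h1;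
     rewrite wreathM1 g1 h1 addr0.
(* The second component of a product depends on the first one of the tail. *)
suff [] : (\prod_i F i)%g.1 = 0 /\ (\prod_i F i)%g.2 x = \sum_i (F i).2 x by [].
apply: (big_rec2 (fun (g : wreath V W) y => g.1 = 0 /\ g.2 x = y)).
  by rewrite ffunE.
move=> i y g _ [g1 <-].
by rewrite wreathM1 F1 g1 wreathM2 g1 !addr0.
Qed.
End Wreath.

Lemma wreathP (V W : finZmodType) (g h : wreath V W) :
  g.1 = h.1 -> (forall x, g.2 x = h.2 x) -> g = h.
Proof. by case: g h => [i f] [j e] /= -> /ffunP->. Qed.

(** * Balanced elements and their powers *)

Section Construction.
Import GRing.Theory.
Variables p r : nat.
Hypothesis p_pr : prime p.

Let q := (p ^ r)%N.
Let n := (p ^ r.+1)%N.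
Let N := (p ^ r.+2)%N.
Local Notation R := 'Z_N.
Local Notation wr := (wreath R R).

Let p_gt0 : 0 < p. Proof. exact: prime_gt0. Qed.
Let p_gt1 : 1 < p. Proof. exact: prime_gt1. Qed.
Let q_gt0 : 0 < q. Proof. by rewrite expn_gt0 p_gt0. Qed.
Let n_gt0 : 0 < n. Proof. by rewrite expn_gt0 p_gt0. Qed.
Let nE : n = (p * q)%N. Proof. by rewrite -expnS. Qed.
Let NE : N = (p * n)%N. Proof. by rewrite -expnS. Qed.
Let N_gt1 : 1 < N. Proof. by rewrite -(exp1n r.+2) ltn_exp2r. Qed.
Let dvd_N_nn : N %| n * n.
Proof. by rewrite -expnD dvdn_exp2l // addSn addnS !ltnS leq_addr. Qed.

Lemma natZp_eq0 l : (l%:R == 0 :> R)%R = (N %| l).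
Proof. by rewrite -val_eqE /= val_Zp_nat. Qed.

Lemma natZp_dvd l : (n %| (l%:R : R)%R) = (n %| l).
Proof.
have dvd_nN : n %| N by rewrite NE dvdn_mull.
by rewrite val_Zp_nat // /dvdn modn_dvdm.
Qed.

Local Open Scope ring_scope.

Definition balanced : {set wr} :=
  [set g : wr | [forall x, \sum_(j < p) g.2 (x + (q * j)%:R) == 0]].

Lemma balanced_group_set : group_set balanced.
Proof.
apply/group_setP; split=> [|g h].
  by rewrite inE; apply/forallP=> x; rewrite big1 // => j _; rewrite ffunE.
rewrite !inE => /forallP Sg /forallP Sh; apply/forallP=> x.
under eq_bigr do rewrite wreathM2 addrAC.
by rewrite big_split /= (eqP (Sg _)) (eqP (Sh _)) addr0.
Qed.
Canonical balanced_group := Group balanced_group_set.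

Lemma balancedP (g : wr) :
  reflect (forall x, \sum_(j < p) g.2 (x + (q * j)%:R) = 0) (g \in balanced).
Proof. by rewrite inE; apply: (iffP forallP) => S x; apply/eqP/S. Qed.

(** The progressions starting at x and at x + q differ only in their end
    points x and x + pq. *)
Lemma balanced_periodic (g : wr) x t :
  g \in balanced -> g.2 (x + (n * t)%:R) = g.2 x.
Proof.
move/balancedP=> Sg; elim: t => [|t IH]; first by rewrite muln0 addr0.
rewrite -{}IH mulnS addnC natrD addrA; move: (x + _) => {}x.
have := Sg (x + q%:R); rewrite -{2}(Sg x) nE mulnC; case: (p) p_gt0 => // p' _.
rewrite big_ord_recr big_ord_recl /= muln0 addr0 addrC -addrA -natrD -mulnS.
under eq_bigr do rewrite -addrA -natrD -mulnS.
exact: addIr.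
Qed.

(** The function part of g ^+ p is the sum of g.2 over x, x + qu, ...,
    x + (p - 1)qu.  Modulo pq these are the points x, x + q, ...,
    x + (p - 1)q in another order. *)
Lemma balanced_expp (g : wr) u :
  g \in balanced -> coprime p u -> g.1 = (q * u)%:R ->
  forall x, (g ^+ p)%g.2 x = 0.
Proof.
move=> Sg co_pu g1 x; rewrite wreathX2 -[RHS](balancedP _ Sg x).
(* Multiplication by u permutes the residues modulo p. *)
pose s (j : 'I_p) := Ordinal (ltn_pmod (u * j) p_gt0).
have s_inj : injective s.
  move=> j l; wlog le_lj : j l / (l <= j)%N => [hw eq_s|].
    by case/orP: (leq_total l j) => /hw => [|/(_ (esym eq_s))]; [exact|].
  move/(congr1 val)/eqP => /=; rewrite eqn_mod_dvd ?leq_mul2l ?le_lj ?orbT //.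
  rewrite -mulnBr Gauss_dvdr // => dvd_p; apply/val_inj/eqP.
  rewrite eqn_leq le_lj andbT -subn_eq0; apply: contraLR dvd_p => nz.
  by rewrite gtnNdvd ?lt0n // (leq_ltn_trans (leq_subr _ _)).
rewrite [RHS](reindex_inj s_inj); apply: eq_bigr => j _ /=.
have -> : g.1 *+ j = (q * ((u * j) %% p) + n * ((u * j) %/ p))%:R.
  rewrite g1 -mulrnA -mulnA {1}(divn_eq (u * j) p) mulnDr addnC nE.
  by rewrite [(p * q)%N]mulnC -mulnA [(p * _)%N]mulnC.
by rewrite natrD addrA balanced_periodic.
Qed.

(** When n does not divide g.1 = p ^ s * u, with s <= r and u prime to p, the
    power g ^+ p ^ (r - s) has shift part q * u, and one more p-th power kills
    its function part. *)
Lemma balanced_expn (g : wr) : g \in balanced ->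
  if (n %| g.1)%N then (g ^+ n)%g.1 = 0 /\ forall x, (g ^+ n)%g.2 x = g.2 x *+ n
  else forall x, (g ^+ n)%g.2 x = 0.
Proof.
move=> Sg; case: ifPn => [/dvdnP[t g1] | ndvd].
  have {}g1 : g.1 = (n * t)%:R by rewrite mulnC -g1 natr_Zp.
  split=> [|x].
    rewrite wreathX1 g1 -mulrnA; apply/eqP; rewrite natZp_eq0 mulnAC.
    exact: dvdn_mulr.
  rewrite wreathX2 (eq_bigr (fun=> g.2 x)) ?sumr_const ?card_ord // => j _.
  by rewrite g1 -mulrnA -mulnA balanced_periodic.
have i_gt0 : (0 < g.1)%N by rewrite lt0n; apply: contra ndvd => /eqP->.
have [u co_pu g1] := pfactor_coprime p_pr i_gt0; set s := logn p g.1 in g1.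
have le_sr : (s <= r)%N.
  rewrite leqNgt; apply: contra ndvd => lt_rs.
  by rewrite g1 dvdn_mull ?dvdn_exp2l.
have -> : (g ^+ n = (g ^+ (p ^ (r - s)) ^+ p) ^+ (p ^ s))%g.
  by rewrite -!expgM -expnS -expnD addnS subnK.
move=> x; rewrite wreathX2 big1 // => j _.
apply: (@balanced_expp _ u) => //; first exact: groupX.
by rewrite wreathX1 -[g.1]natr_Zp -mulrnA g1 -mulnA -expnD addnC subnK // mulnC.
Qed.

(** For l = 1 this is the base group of the wreath product; for l = n it is the
    subgroup of index p of the elements whose shift part is divisible by p. *)
Definition shift_torsion l : {set wr} := [set g : wr | g.1 *+ l == 0].

Lemma shift_torsion_group_set l : group_set (shift_torsion l).
Proof.
apply/group_setP; split=> [|g h]; first by rewrite inE /= mul0rn.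
by rewrite !inE wreathM1 mulrnDl => /eqP-> /eqP->; rewrite addr0.
Qed.
Canonical shift_torsion_group l := Group (shift_torsion_group_set l).

Lemma shift_torsion_norm l (G : {group wr}) : G \subset 'N(shift_torsion l)%g.
Proof.
apply/subsetP=> g _; rewrite inE; apply/subsetP=> _ /imsetP[h Th ->].
by move: Th; rewrite !inE wreathJ1.
Qed.

(** This subgroup contains all the n-th powers of balanced elements, hence the
    agemo, and it does not contain the seed below. *)
Definition torsion : {set wr} :=
  [set g : wr | (g.1 *+ p == 0) && [forall x, g.2 x *+ p == 0]].

Lemma torsion_group_set : group_set torsion.
Proof.
apply/group_setP; split=> [|g h].
  by rewrite inE /= mul0rn eqxx; apply/forallP=> x; rewrite ffunE mul0rn.
rewrite !inE => /andP[/eqP g1 /forallP g2] /andP[/eqP h1 /forallP h2].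
rewrite wreathM1 mulrnDl g1 h1 addr0 eqxx; apply/forallP=> x.
by rewrite wreathM2 mulrnDl (eqP (g2 _)) (eqP (h2 _)) addr0.
Qed.
Canonical torsion_group := Group torsion_group_set.

Lemma balanced_expn_torsion (g : wr) : g \in balanced -> (g ^+ n)%g \in torsion.
Proof.
move=> Sg; have mulN (y : R) : y *+ n *+ p = 0.
  by rewrite -mulrnA mulnC -NE -mulr_natr pchar_Zp // mulr0.
rewrite inE wreathX1 mulN eqxx; apply/forallP=> x.
case: ifP (balanced_expn Sg) => _ => [[_ ->]|->]; first by rewrite mulN.
by rewrite mul0rn.
Qed.

(** Without the disjunction this may fail: a shift part of order p can collect
    a nonzero sum of values of the function part. *)
Lemma torsion_expp (g : wr) :
  g \in torsion -> g.1 = 0 \/ (forall x, g.2 x = 0) ->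
  (g ^+ p)%g = 1%g.
Proof.
rewrite inE => /andP[/eqP g1 /forallP g2] g0; apply: wreathP => [|x].
  by rewrite wreathX1 g1.
rewrite wreathX2 [RHS]ffunE; case: g0 => [-> | g0]; last by rewrite big1.
under eq_bigr do rewrite mul0rn addr0.
by rewrite sumr_const card_ord; apply/eqP.
Qed.

Lemma balanced_expN (g : wr) : g \in balanced -> (g ^+ N = 1)%g.
Proof.
move=> Sg; have -> : (g ^+ N = g ^+ n ^+ p)%g by rewrite -expgM mulnC -NE.
apply: torsion_expp.
  exact: balanced_expn_torsion.
by case: ifP (balanced_expn Sg) => _ => [[-> _]|]; [left | right].
Qed.

(** * The two generators *)

Definition shift : wr := (1, [ffun=> 0]).
Definition indic (x : R) : R := (n %| x)%N%:R.
(** A difference c (x + q) - c x, where c is of period pq, is balanced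
    because its sums telescope. *)
Definition seed : wr := (0, [ffun x => indic (x + q%:R) - indic x]).

Lemma indic_nat l : indic l%:R = (n %| l)%N%:R.
Proof. by rewrite /indic natZp_dvd. Qed.

Lemma shift_balanced : shift \in balanced.
Proof. by apply/balancedP=> x; rewrite big1 // => j _; rewrite ffunE. Qed.

Lemma seed_balanced : seed \in balanced.
Proof.
apply/balancedP=> x.
under eq_bigr => j _ do rewrite ffunE -addrA -natrD addnC -mulnS.
rewrite -(big_mkord xpredT
  (fun j => indic (x + (q * j.+1)%:R) - indic (x + (q * j)%:R))).
rewrite telescope_sumr // muln0 addr0 mulnC -nE -[x]natr_Zp -natrD !indic_nat.
by rewrite dvdn_addl // subrr.
Qed.

Lemma shiftX1 l : (shift ^+ l)%g.1 = l%:R. Proof. by rewrite wreathX1. Qed.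
Lemma shiftX2 l x : (shift ^+ l)%g.2 x = 0.
Proof. by rewrite wreathX2 big1 // => j _; rewrite ffunE. Qed.

Lemma seedJ2 l x : (seed ^ (shift ^+ l))%g.2 x = seed.2 (x + l%:R).
Proof.
by rewrite conjgE !wreathM2 shiftX2 addr0 shiftX1 ffunE /= shiftX2 oppr0 add0r.
Qed.

(** The translates of the seed by 0, ..., q - 1, evaluated at the points
    n - q - j, form the identity matrix. *)
Lemma seed_eval i j : (i < q)%N -> (j < q)%N ->
  seed.2 ((n - (q + j))%:R + i%:R) = (i == j)%:R.
Proof.
move=> lt_iq lt_jq; rewrite ffunE -!natrD !indic_nat.
have le_n : (q + j < n)%N.
  rewrite (leq_trans (_ : _ < q + q)%N) ?ltn_add2l // addnn -mul2n nE.
  by rewrite leq_mul2r p_gt1 orbT.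
have -> : (n %| n - (q + j) + i)%N = false.
  rewrite gtnNdvd //; first by rewrite ltn_addr // subn_gt0.
  by rewrite -[ltnRHS](subnK (ltnW le_n)) ltn_add2l ltn_addr.
(* Modulo n, the argument of the remaining indicator is i - j. *)
rewrite subr0; congr (_%:R); congr nat_of_bool.
rewrite -[LHS]/(_ == _) -[0%N in LHS](mod0n n) -(eqn_modDr j) add0n.
have -> : (n - (q + j) + i + q + j = n + i)%N.
  by rewrite -addnA addnAC subnK ?(ltnW le_n).
have lt_qn : (q <= n)%N by rewrite nE leq_pmull.
by rewrite modnDl !modn_small ?(leq_trans _ lt_qn).
Qed.

Local Open Scope group_scope.

(** * The group generated by the shift and the seed *)

Definition seed_group : {group wr} := <<[set shift; seed]>>%G.
Local Notation P := seed_group.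

Lemma shift_in : shift \in P. Proof. by rewrite mem_gen ?set21. Qed.
Lemma seed_in : seed \in P. Proof. by rewrite mem_gen ?set22. Qed.

Lemma seed_group_balanced : P \subset balanced.
Proof. by rewrite gen_subG subUset !sub1set shift_balanced seed_balanced. Qed.

Lemma seed_group_pgroup : p.-group P.
Proof.
apply: pgroupS (subsetT _) _.
rewrite /pgroup cardsT card_prod card_ffun card_ord.
by rewrite Zp_cast // pnatM !pnatX pnat_id.
Qed.

Lemma Mho_seed_group_torsion : 'Mho^(r.+1)(P) \subset torsion.
Proof.
rewrite (MhoE _ seed_group_pgroup) gen_subG; apply/subsetP=> _ /imsetP[x Px ->].
by apply: balanced_expn_torsion; apply: (subsetP seed_group_balanced).
Qed.

Local Notation z := (shift ^+ n).
Local Notation A := (P :&: shift_torsion_group 1)%G.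
Local Notation H := (P :&: shift_torsion_group n)%G.

Lemma order_shiftXn : #[z] = p.
Proof.
apply: nt_prime_order => //.
  by rewrite -expgM mulnC -NE balanced_expN ?shift_balanced.
apply: contraTneq (isT : true) => /(congr1 fst); rewrite shiftX1 => /eqP.
by rewrite natZp_eq0 gtnNdvd // NE ltn_Pmull.
Qed.

(** If p does not divide x.1 then x ^+ n is the power of z by an exponent prime
    to the order p of z. *)
Lemma shiftXn_in_cycle x : x \in P :\: H -> z \in <[x]>.
Proof.
case/setDP=> Px; rewrite inE Px inE /= => nHx.
have Sx := subsetP seed_group_balanced x Px.
case: ifP (balanced_expn Sx) => _ => [[x1 _]|x2].
  by rewrite -wreathX1 x1 eqxx in nHx.
have xnE : x ^+ n = z ^+ x.1.
  rewrite -expgM; apply: wreathP => [|y]; last by rewrite x2 shiftX2.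
  by rewrite wreathX1 shiftX1 mulnC natrM natr_Zp mulr_natr.
have : generator <[z]> (z ^+ x.1).
  rewrite generator_coprime order_shiftXn prime_coprime //.
  apply: contra nHx => /dvdnP[t x1].
  by rewrite -[x.1]natr_Zp -mulrnA natZp_eq0 x1 -mulnA -NE dvdn_mull.
by rewrite -xnE /generator => /eqP zx; rewrite -cycle_subG zx cycleX.
Qed.

Lemma Mho_seed_group_sub : 'Mho^(r.+1)(P) \subset <[z]> * A.
Proof.
apply/subsetP=> g Mg; have := subsetP Mho_seed_group_torsion g Mg.
rewrite inE => /andP[g1 _].
have Pg : g \in P := subsetP (Mho_sub _ _) g Mg.
have /dvdnP[t gt] : n %| g.1.
  by rewrite -(dvdn_pmul2l p_gt0) -NE -natZp_eq0 mulnC natrM natr_Zp mulr_natr.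
rewrite -[g](mulKVg (z ^+ t)) mem_mulg ?mem_cycle // inE.
rewrite groupM ?groupV ?groupX ?shift_in //= inE wreathM1 wreathV1.
by rewrite -expgM shiftX1 mulnC -gt natr_Zp addNr mul0rn.
Qed.

Lemma base_not_sub_Mho : ~~ (A \subset 'Mho^(r.+1)(P)).
Proof.
apply/subsetPn; exists seed; first by rewrite !inE seed_in eqxx.
apply: contraL (isT : true) => /(subsetP Mho_seed_group_torsion).
rewrite inE => /andP[_ /forallP/(_ (n - q)%:R)].
have := @seed_eval 0 0 q_gt0 q_gt0; rewrite addn0 addr0 => ->.
by rewrite natZp_eq0 gtnNdvd // NE ltn_Pmulr // -(exp1n r.+1) ltn_exp2r.
Qed.

(** The n-th powers of the translates of the seed by 0, ..., q - 1 are
    independent elements of order p, by [seed_eval]. *)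
Lemma leq_card_base_Mho : p ^ q <= #|A :&: 'Mho^(r.+1)(P)|.
Proof.
pose F (c : {ffun 'I_q -> 'I_p}) : wr :=
  \prod_(i < q) ((seed ^ (shift ^+ i)) ^+ n) ^+ c i.
have base1 (c : {ffun 'I_q -> 'I_p}) (i : 'I_q) :
    (((seed ^ (shift ^+ i)) ^+ n) ^+ c i).1 = 0%R.
  by rewrite !wreathX1 wreathJ1 !mul0rn.
have F1 c : (F c).1 = 0%R by exact: (proj1 (wreath_base_prod (base1 c))).
have F2 c (j : 'I_q) : ((F c).2 (n - (q + j))%:R = (n * c j)%:R)%R.
  rewrite (proj2 (wreath_base_prod (base1 c))) /=.
  have term (i : 'I_q) :
    ((((seed ^ (shift ^+ i)) ^+ n) ^+ c i)%g.2 (n - (q + j))%:R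
       = (i == j)%:R *+ (n * c i))%R.
    rewrite !wreath_baseX ?wreathX1 ?wreathJ1 ?mul0rn //.
    by rewrite seedJ2 seed_eval // mulrnA.
  rewrite (bigD1 j) //= term eqxx big1 ?addr0 // => i /negPf ne_ij.
  by rewrite term ne_ij mul0rn.
have Finj : injective F.
  move=> c d eqF; apply/ffunP=> j; apply/val_inj => /=.
  have := F2 c j; rewrite eqF F2 => /(congr1 val) /=.
  rewrite !val_Zp_nat // !modn_small ?NE ?[(p * n)%N]mulnC ?ltn_pmul2l //.
  by move/eqP; rewrite eqn_pmul2l // => /eqP.
have sFM : F @: setT \subset A :&: 'Mho^(r.+1)(P).
  apply/subsetP=> _ /imsetP[c _ ->].
  have MF : F c \in 'Mho^(r.+1)(P).
    apply: group_prod => i _; apply: groupX; apply: Mho_p_elt.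
      by rewrite groupJ ?groupX ?seed_in ?shift_in.
    apply: (mem_p_elt seed_group_pgroup).
    by rewrite groupJ ?groupX ?seed_in ?shift_in.
  by rewrite inE MF inE (subsetP (Mho_sub _ _) _ MF) inE F1 mul0rn eqxx.
have := subset_leq_card sFM; rewrite card_imset // cardsT card_ffun !card_ord.
by [].
Qed.
End Construction.

Theorem corollary2p13 (p m : nat) (p_pr : prime p) (p_ge5 : 5 <= p)
    (m_gt0 : 0 < m) :
  exists (gT : finGroupType) (G : {group gT}),
    [/\ p.-group G,
        'm(G) = 2,
        (forall e : nat, exponent G = (p ^ e)%N ->
           #|'Mho^(e.-1)(G)| = (p ^ m)%N)
      & ~ beauville_group G].
Proof.
have p_gt1 := prime_gt1 p_pr; have p_gt0 := prime_gt0 p_pr.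
have N_gt1 : 1 < p ^ m.+2 by rewrite -(exp1n m.+2) ltn_exp2r.
(* Any r with m.-1 <= p ^ r would do; r = m is one. *)
pose P := seed_group p m; pose n := (p ^ m.+1)%N.
pose A := (P :&: shift_torsion_group p m 1)%G.
pose H := (P :&: shift_torsion_group p m n)%G.
have tors l : (shift p m ^+ n \in shift_torsion p m l) = (p ^ m.+2 %| n * l).
  by rewrite inE shiftX1 -GRing.mulrnA natZp_eq0.
have [|||||||||||||Q HQ] :=
  @exists_quotient_small_Mho _ p m.+1 m P H A (shift p m ^+ n) p_pr m_gt0.
- exact: seed_group_pgroup.
- by rewrite (leq_trans (grank_min _)) // cards2; case: eqP.
- apply/exponentP=> x /(subsetP (seed_group_balanced m p_pr)).
  exact: balanced_expN.
- rewrite properE subsetIl /=; apply/subsetPn; exists (shift p m).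
    exact: shift_in.
  rewrite inE negb_and; apply/orP; right.
  by rewrite inE natZp_eq0 // gtnNdvd ?expn_gt0 ?p_gt0 // ltn_exp2l.
- by rewrite /normal subsetIl normsI ?normG ?shift_torsion_norm.
- rewrite setIS //; apply/subsetP=> g; rewrite !inE => /eqP g1.
  by rewrite -[g.1]GRing.mulr1n g1 GRing.mul0rn.
- exact: order_shiftXn.
- rewrite inE tors negb_and muln1 gtnNdvd ?orbT ?expn_gt0 ?p_gt0 //.
  by rewrite ltn_exp2l.
- exact: shiftXn_in_cycle.
- apply: Mho_p_elt; first exact: shift_in.
  by rewrite (mem_p_elt (seed_group_pgroup m p_pr)) ?shift_in.
- exact: Mho_seed_group_sub.
- exact: base_not_sub_Mho.
- apply: leq_trans (leq_card_base_Mho m p_pr).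
  rewrite leq_exp2l // (leq_trans (leq_pred m)) //.
  exact/ltnW/ltn_expl.
by exists _, (P / Q)%G.
Qed.
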